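(* Let $(\mathbb{Z},E)$ be a pseudo-free self-similar graph, where $E$ is a finite, source-free directed graph, and write $\mathbb{Z}=\langle a\rangle$ multiplicatively. Assume that for any cycle $C$ in $E$ with no entrance, if $p$ is the minimal positive integer such that $a^p$ fixes a vertex on $C$, then $a^p|_C\ne a^{\pm p}$ (i.e. $a^p|_C\neq a^p$ and $a^p|_C\ne a^{-p}$). Then the subgroupoid $\mathcal{S}_{\mathrm{sym}}$ is maximal among open abelian subgroupoids of $\operatorname{Iso}(\mathcal{G}_{\mathbb{Z},E})^\circ$.
   Context: Graphs. $\mathbb{N}=\{0,1,2,\dots\}$. A directed graph $E=(E^0,E^1,r,s)$ has vertex set $E^0$, edge set $E^1$, range and source maps $r,s\colon E^1\to E^0$. It is finite if $E^0,E^1$ are finite, and source-free if every vertex is the range of some edge. A path of length $n\ge1$ is a word $e_1\cdots e_n$ of edges with $s(e_i)=r(e_{i+1})$, with range $r(e_1)$ and source $s(e_n)$; vertices are the paths of length $0$. $E^*$ is the set of finite paths, $|\mu|$ the length. $E^\infty$ is the set of infinite paths $x=e_1e_2\cdots$ ($s(e_i)=r(e_{i+1})$), $r(x)=r(e_1)$; $x(m,n)=e_{m+1}\cdots e_n$ for $m<n$, $x(n,n)=r(e_{n+1})$. $vE^\infty$ is the set of infinite paths with range $v$. A cycle is a path $C=\mu_1\cdots\mu_k$ ($k\ge1$, $\mu_i\in E^1$) with $r(C)=s(C)$; it has no entrance if $e\in E^1$, $r(e)=r(\mu_i)$ for some $i$ implies $e=\mu_i$. Self-similar graph $(G,E)$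 ($G$ a countable discrete group with identity $1_G$; here $G=\mathbb{Z}$): $G$ acts on $E^*$ by bijections preserving lengths and commuting with $r,s$, with a restriction map $G\times E^*\to G$, $(g,\mu)\mapsto g|_\mu$, such that $(gh)|_\mu=g|_{h\cdot\mu}h|_\mu$; $g|_v=g$ for $v\in E^0$; $1_G|_\mu=1_G$; $g|_{\mu\nu}=g|_\mu|_\nu$ and $g\cdot(\mu\nu)=(g\cdot\mu)(g|_\mu\cdot\nu)$ whenever $s(\mu)=r(\nu)$. The action extends to $E^\infty$ by $(g\cdot x)(p,q)=g|_{x(0,p)}\cdot x(p,q)$, and $g|_x\colon\mathbb{N}\to G$ is $p\mapsto g|_{x(0,p)}$. $(G,E)$ is pseudo-free if $g\cdot\mu=\mu$ and $g|_\mu=1_G$ imply $g=1_G$. Groupoid. $Q(\mathbb{N},G)$ is the group of functions $\mathbb{N}\to G$ (pointwise product) modulo eventual equality, $[f]$ the class of $f$. For $n\in\mathbb{Z}$, $\mathcal{T}_n(f)(p)=f(p-n)$ if $p\ge n$ and $1_G$ otherwise, inducing an automorphism $\mathcal{T}_n$ of $Q(\mathbb{N},G)$. Then $$\mathcal{G}_{G,E}=\{(\mu(g\cdot x);\mathcal{T}_{|\mu|}([g|_x]),|\mu|-|\nu|;\nu x): g\in G,\ \mu,\nu\in E^*,\ s(\mu)=g\cdot s(\nu),\ x\in s(\nu)E^\infty\}$$ with $r(x;[f],k;y)=(x;[1_G],0;x)$, $s(x;[f],k;y)=(y;[1_G],0;y)$, product $(x;[f],k;y)(y;[h],l;z)=(x;[f]\mathcal{T}_k([h]),k+l;z)$,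 inverse $(y;\mathcal{T}_{-k}([f]^{-1}),-k;x)$. Its topology is generated by the cylinder sets $\mathcal{Z}(\mu,g,\nu)=\{(\mu(g\cdot x);\mathcal{T}_{|\mu|}([g|_x]),|\mu|-|\nu|;\nu x):x\in s(\nu)E^\infty\}$ with $s(\mu)=g\cdot s(\nu)$. $\operatorname{Iso}(\mathcal{G})=\{\mathfrak g:r(\mathfrak g)=s(\mathfrak g)\}$, and $\operatorname{Iso}(\mathcal{G})^\circ$ is its interior in $\mathcal{G}$. Cycline triples. $(\mu,g,\nu)$ is a cycline triple if $s(\mu)=g\cdot s(\nu)$ and $\mu(g\cdot x)=\nu x$ for all $x\in s(\nu)E^\infty$; it is symmetric if $\mu=\nu$. $\mathcal{S}_{\mathrm{sym}}$ is the union of the sets $\mathcal{Z}(\mu,g,\mu)$ over all symmetric cycline triples. A subgroupoid of $\operatorname{Iso}(\mathcal{G})$ is abelian if any two composable elements of it commute. ''Maximal among open abelian subgroupoids'' means that it is itself open and abelian and is not properly contained in another open abelian subgroupoid of $\operatorname{Iso}(\mathcal{G}_{\mathbb{Z},E})^\circ$. *)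

(* Defs.v *)
From HB Require Import structures.
From mathcomp Require Import all_boot all_order all_algebra.
From mathcomp Require Import boolp classical_sets topology.

Set Implicit Arguments.
Unset Strict Implicit.
Unset Printing Implicit Defensive.

Import Order.TTheory GRing.Theory Num.Theory.

Local Open Scope classical_set_scope.
Local Open Scope quotient_scope.
Local Open Scope group_scope.

(* Finite directed graphs; a path e_1 ... e_n satisfies s(e_i) = r(e_(i+1)),
   so it is read from its range r(e_1) back to its source s(e_n). *)

Record digraph := Digraph {
  vertex : finType;
  edge : finType;
  erng : edge -> vertex;
  esrc : edge -> vertex
}.

Definition source_free (E : digraph) : Prop :=
  forall v : vertex E, exists e : edge E, erng e = v.

Section Paths.
Variable E : digraph.

Fixpoint walk (v : vertex E) (s : seq (edge E)) : bool :=
  if s is e :: s' then (erng e == v) && walk (esrc e) s' else true.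

(* The range is stored so that the vertices are the paths without edges. *)
Record finpath := FinPath {
  prng : vertex E;
  pedges : seq (edge E);
  finpathP : walk prng pedges
}.

Definition psrc (m : finpath) : vertex E := last (prng m) (map (@esrc E) (pedges m)).

Definition plen (m : finpath) : nat := size (pedges m).

Definition vpath (v : vertex E) : finpath := @FinPath v [::] isT.

Lemma finpath_eq (m n : finpath) :
  prng m = prng n -> pedges m = pedges n -> m = n.
Proof.
case: m n => [v s p] [w t q] /= evw est; subst w t.
by rewrite (bool_irrelevance p q).
Qed.

Lemma walk_cat v s t :
  walk v (s ++ t) = walk v s && walk (last v (map (@esrc E) s)) t.
Proof. by elim: s v => [|e s IHs] v //=; rewrite IHs andbA. Qed.

Fact pcat_subproof (m n : finpath) :
  psrc m = prng n -> walk (prng m) (pedges m ++ pedges n).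
Proof. by move=> mn; rewrite walk_cat finpathP -/(psrc m) mn finpathP. Qed.

(* The concatenation mn; a junk value unless s(m) = r(n). *)
Definition pcat (m n : finpath) : finpath :=
  if psrc m =P prng n is ReflectT mn then FinPath (pcat_subproof mn) else m.

Record infpath := InfPath {
  iedge :> nat -> edge E;
  iedgeP : forall n, esrc (iedge n) = erng (iedge n.+1)
}.

Lemma infpath_eq (x y : infpath) : x =1 y -> x = y.
Proof.
case: x y => [x px] [y py] /= /funext exy; subst y.
by rewrite (Prop_irrelevance px py).
Qed.

(* The edges e_1 e_2 ... of x are indexed from 0. *)
Definition irng (x : infpath) : vertex E := erng (x 0).

Fact iseg_subproof (x : infpath) m k :
  walk (erng (x m)) (mkseq (fun i => x (m + i)%N) k).
Proof.
rewrite /mkseq; elim: k m => [|k IHk] m //=.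
rewrite addn0 eqxx /= iedgeP (iotaDl 1 0) -map_comp.
rewrite (_ : map _ _ = map (fun i => x (m.+1 + i)%N) (iota 0 k)) ?IHk //.
by apply: eq_map => i /=; rewrite addnA addn1.
Qed.

(* The segment x(m,n); it is a vertex if m = n. *)
Definition iseg (x : infpath) (m n : nat) : finpath :=
  FinPath (iseg_subproof x m (n - m)).

Fact icat_subproof (m : finpath) (x : infpath) : psrc m = irng x ->
  forall n, esrc (nth (x (n - plen m)%N) (pedges m) n) =
            erng (nth (x (n.+1 - plen m)%N) (pedges m) n.+1).
Proof.
rewrite /psrc /plen /irng; case: m => v s /=.
elim: s v => [|e s IHs] v /=; first by move=> _ _ n; rewrite !nth_nil !subn0 iedgeP.
move=> /andP[_ ws] sx [|n] /=; last by rewrite !subSS; exact: (IHs _ ws sx).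
by case: s {IHs} ws sx => [|f s] /=; [rewrite subSS subn0 | case/andP => /eqP-> _].
Qed.

(* The concatenation mx; a junk value unless s(m) = r(x). *)
Definition icat (m : finpath) (x : infpath) : infpath :=
  if psrc m =P irng x is ReflectT mx then InfPath (icat_subproof mx) else x.

Definition is_cycle (C : finpath) : Prop := (0 < plen C)%N /\ prng C = psrc C.

Definition no_entrance (C : finpath) : Prop :=
  forall m e, m \in pedges C -> erng e = erng m -> e = m.

Definition vertex_on (C : finpath) (v : vertex E) : Prop :=
  exists2 m, m \in pedges C & v = erng m.

End Paths.

Record self_similar (G : groupType) (E : digraph) := SelfSimilar {
  act : G -> finpath E -> finpath E;
  rst : G -> finpath E -> G;
  act1 : forall m, act 1 m = m;
  actM : forall g h m, act (g * h) m = act g (act h m);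
  plen_act : forall g m, plen (act g m) = plen m;
  prng_act : forall g m, vpath (prng (act g m)) = act g (vpath (prng m));
  psrc_act : forall g m, vpath (psrc (act g m)) = act g (vpath (psrc m));
  rstM : forall g h m, rst (g * h) m = rst g (act h m) * rst h m;
  rst_vpath : forall g v, rst g (vpath v) = g;
  rst1 : forall m, rst 1 m = 1;
  rst_pcat : forall g m n, psrc m = prng n ->
    rst g (pcat m n) = rst (rst g m) n;
  (* the first conjunct says that the right-hand side of the second one
     is a path *)
  act_pcat : forall g m n, psrc m = prng n ->
    psrc (act g m) = prng (act (rst g m) n) /\
    act g (pcat m n) = pcat (act g m) (act (rst g m) n)
}.

Section SelfSimilarTheory.
Variables (G : groupType) (E : digraph) (S : self_similar G E).

Definition pseudo_free : Prop :=
  forall (g : G) (m : finpath E), act S g m = m -> rst S g m = 1 -> g = 1.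

Definition vact (g : G) (v : vertex E) : vertex E := prng (act S g (vpath v)).

Lemma psrc_iseg (x : infpath E) m n :
  (m <= n)%N -> psrc (iseg x m n) = erng (x n).
Proof.
rewrite /psrc /= => /subnKC <-; rewrite addKn; case: (n - m)%N => [|k].
  by rewrite addn0.
by rewrite /mkseq -addn1 iotaD map_cat map_cat last_cat /= iedgeP addn1 addnS.
Qed.

Lemma iseg_cat (x : infpath E) m n p : (m <= n <= p)%N ->
  iseg x m p = pcat (iseg x m n) (iseg x n p).
Proof.
case/andP => mn np; rewrite /pcat; case: eqP => [e|[]]; last exact: psrc_iseg.
apply: finpath_eq => //=; rewrite /mkseq.
have -> : (p - m = (n - m) + (p - n))%N by rewrite addnC addnBA // subnK.
rewrite iotaD map_cat add0n; congr (_ ++ _).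
rewrite -{1}(addn0 (n - m)%N) iotaDl -map_comp.
apply: eq_map => i /=.
by rewrite addnA subnKC.
Qed.

(* The edges of g.x are determined by
     (g.x)(n, n+1) = g|_(x(0,n)) . x(n, n+1);
   the default value x n is never used since the right-hand side has length 1. *)
Definition iact_edge (g : G) (x : infpath E) (n : nat) : edge E :=
  head (x n) (pedges (act S (rst S g (iseg x 0 n)) (iseg x n n.+1))).

Lemma iact_edgeE (g : G) (x : infpath E) n :
  pedges (act S (rst S g (iseg x 0 n)) (iseg x n n.+1)) = [:: iact_edge g x n].
Proof.
rewrite /iact_edge; set m := act _ _ _.
have : plen m = 1%N by rewrite plen_act /plen /= size_mkseq subSnn.
by rewrite /plen; case: (pedges m) => [|e []].
Qed.

Lemma erng_iact_edge (g : G) (x : infpath E) n :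
  erng (iact_edge g x n) = prng (act S (rst S g (iseg x 0 n)) (iseg x n n.+1)).
Proof.
move: (finpathP (act S (rst S g (iseg x 0 n)) (iseg x n n.+1))).
by rewrite iact_edgeE /= andbT => /eqP.
Qed.

Lemma rst_iseg (g : G) (x : infpath E) n p : (n <= p)%N ->
  rst S g (iseg x 0 p) = rst S (rst S g (iseg x 0 n)) (iseg x n p).
Proof. by move=> np; rewrite (@iseg_cat x 0 n p) // rst_pcat // psrc_iseg. Qed.

Fact iact_subproof (g : G) (x : infpath E) n :
  esrc (iact_edge g x n) = erng (iact_edge g x n.+1).
Proof.
rewrite erng_iact_edge (rst_iseg g x (leqnSn n)).
have [|<- _] := act_pcat S (rst S g (iseg x 0 n))
  (m := iseg x n n.+1) (n := iseg x n.+1 n.+2); first by rewrite psrc_iseg.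
by rewrite /psrc iact_edgeE.
Qed.

Definition iact (g : G) (x : infpath E) : infpath E :=
  InfPath (iact_subproof g x).

Lemma iseg_iact (g : G) (x : infpath E) p q : (p <= q)%N ->
  iseg (iact g x) p q = act S (rst S g (iseg x 0 p)) (iseg x p q).
Proof.
move=> pq; rewrite -(subnKC pq); elim: (q - p)%N => [|k IHk].
  rewrite addn0; set h := rst _ _ _; apply: finpath_eq.
    rewrite /= erng_iact_edge -/h.
    have := prng_act S h (iseg x p p.+1); rewrite -(prng_act S h (iseg x p p)).
    by case.
  have := plen_act S h (iseg x p p); rewrite /plen /= subnn /=.
  by move/size0nil->.
have le1 : (p <= p + k <= p + k.+1)%N by rewrite leq_addr addnS leqnSn.
rewrite (iseg_cat _ le1) (iseg_cat x le1) IHk.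
have [|cmp ->] := act_pcat S (rst S g (iseg x 0 p))
  (m := iseg x p (p + k)) (n := iseg x (p + k) (p + k.+1)).
  by rewrite psrc_iseg // leq_addr.
congr pcat; rewrite -rst_iseg ?leq_addr // addnS; apply: finpath_eq.
  by rewrite /= erng_iact_edge.
by rewrite iact_edgeE /= subSnn /mkseq /= addn0.
Qed.

Definition irst (g : G) (x : infpath E) : nat -> G := fun p => rst S g (iseg x 0 p).

End SelfSimilarTheory.

Section EventualQuotient.
Variable G : groupType.
Implicit Types f h : nat -> G.

Definition eventually_eq f h : bool :=
  `[< exists N : nat, forall p : nat, (N <= p)%N -> f p = h p >].

Fact eventually_eq_equiv : equiv_class_of eventually_eq.
Proof.
split=> [f|f h|h f k].
- by apply/asboolP; exists 0%N.
- by apply/asbool_equiv_eq; split=> -[N fh]; exists N => p /fh.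
- move=> /asboolP[N fh] /asboolP[M hk]; apply/asboolP; exists (maxn N M) => p.
  by rewrite geq_max => /andP[/fh-> /hk].
Qed.

Canonical eventually_eq_rel := EquivRelPack eventually_eq_equiv.

Definition Q := {eq_quot eventually_eq}.
HB.instance Definition _ := Choice.on Q.
HB.instance Definition _ := EqQuotient.on Q.

Lemma Q_eqP f h : reflect (exists N : nat, forall p : nat, (N <= p)%N -> f p = h p)
                          (\pi_Q f == \pi_Q h).
Proof. by rewrite piE; exact: asboolP. Qed.

Lemma repr_piQ f : exists N : nat, forall p : nat, (N <= p)%N -> repr (\pi_Q f) p = f p.
Proof. by apply/Q_eqP; rewrite reprK eqxx. Qed.

Lemma eq_piQ f h : f =1 h -> \pi_Q f = \pi_Q h.
Proof. by move/funext->. Qed.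

Definition Qmul (a b : Q) : Q := \pi_Q (fun p => repr a p * repr b p).
Definition Qinv (a : Q) : Q := \pi_Q (fun p => (repr a p)^-1).
Definition Qone : Q := \pi_Q (fun=> 1).

Lemma Qmul_pi f h : Qmul (\pi_Q f) (\pi_Q h) = \pi_Q (fun p => f p * h p).
Proof.
have [N fN] := repr_piQ f; have [M hM] := repr_piQ h.
apply/eqP/Q_eqP; exists (maxn N M) => p.
by rewrite geq_max => /andP[/fN-> /hM->].
Qed.

Lemma Qinv_pi f : Qinv (\pi_Q f) = \pi_Q (fun p => (f p)^-1).
Proof.
by have [N fN] := repr_piQ f; apply/eqP/Q_eqP; exists N => p /fN->.
Qed.

Fact QmulA : associative Qmul.
Proof.
elim/quotW=> f; elim/quotW=> h; elim/quotW=> k.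
rewrite (Qmul_pi h k) (Qmul_pi f h) !Qmul_pi.
by apply: eq_piQ => p; rewrite mulgA.
Qed.

Fact Qmul1 : left_id Qone Qmul.
Proof.
by elim/quotW=> f; rewrite Qmul_pi; apply: eq_piQ => p; rewrite mul1g.
Qed.

Fact Qmulr1 : right_id Qone Qmul.
Proof.
by elim/quotW=> f; rewrite Qmul_pi; apply: eq_piQ => p; rewrite mulg1.
Qed.

Fact QmulV : left_inverse Qone Qinv Qmul.
Proof.
elim/quotW=> f; rewrite Qinv_pi Qmul_pi.
by apply: eq_piQ => p; rewrite mulVg.
Qed.

Fact QmulVr : right_inverse Qone Qinv Qmul.
Proof.
elim/quotW=> f; rewrite Qinv_pi Qmul_pi.
by apply: eq_piQ => p; rewrite mulgV.
Qed.

HB.instance Definition _ := isGroup.Build Q QmulA Qmul1 Qmulr1 QmulV QmulVr.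

Definition tshift (n : int) f : nat -> G :=
  fun p => if (n <= p%:Z)%R then f `|(p%:Z - n)%R|%N else 1.

Definition Tshift (n : int) (a : Q) : Q := \pi_Q (tshift n (repr a)).

Lemma Tshift_pi n f : Tshift n (\pi_Q f) = \pi_Q (tshift n f).
Proof.
have [N fN] := repr_piQ f; apply/eqP/Q_eqP; exists (N + `|n|)%N => p Np.
rewrite /tshift; case: ifP => // np; apply: fN.
rewrite -lez_nat gez0_abs ?subr_ge0 // lerBrDr.
by apply: le_trans (_ : (N + `|n|)%:Z <= _)%R; rewrite ?lez_nat // PoszD lerD2l lez_abs.
Qed.

End EventualQuotient.

(* A quadruple (x; q, k; y).  The phantom parameter S fixes the topology. *)
Record quad (G : groupType) (E : digraph) (S : self_similar G E) := Quad {
  qleft : infpath E;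
  qcocycle : Q G;
  qdegree : int;
  qright : infpath E
}.

HB.instance Definition _ G E (S : self_similar G E) := gen_eqMixin (quad S).
HB.instance Definition _ G E (S : self_similar G E) := gen_choiceMixin (quad S).

Section Groupoid.
Variables (G : groupType) (E : digraph) (S : self_similar G E).
Implicit Types (m n : finpath E) (g : G) (x : infpath E) (a b : quad S)
  (H : set (quad S)).

Definition cylinder_elt m g n x : quad S :=
  Quad S (icat m (iact S g x)) (Tshift (plen m)%:Z (\pi_(Q G) (irst S g x)))
         ((plen m)%:Z - (plen n)%:Z)%R (icat n x).

Definition cylinder m g n : set (quad S) :=
  [set cylinder_elt m g n x | x in [set x | irng x = psrc n]].

Definition groupoid : set (quad S) :=
  [set a | exists m g n x, [/\ psrc m = vact S g (psrc n), irng x = psrc n &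
                               a = cylinder_elt m g n x]].

Definition grng a : quad S := Quad S (qleft a) 1 0%R (qleft a).
Definition gsrc a : quad S := Quad S (qright a) 1 0%R (qright a).

Definition composable a b : Prop := gsrc a = grng b.

(* meaningful when a and b are composable *)
Definition gmul a b : quad S :=
  Quad S (qleft a) (qcocycle a * Tshift (qdegree a) (qcocycle b))
         (qdegree a + qdegree b)%R (qright b).

Definition ginv a : quad S :=
  Quad S (qright a) (Tshift (- qdegree a)%R (qcocycle a)^-1)
         (- qdegree a)%R (qleft a).

Definition cylinders : set (set (quad S)) :=
  [set U | exists m g n, psrc m = vact S g (psrc n) /\ U = cylinder m g n].

End Groupoid.

(* The cylinder sets cover the groupoid, which is therefore an open subset of
   the type of quadruples with the topology below.  Hence a set of elements of
   the groupoid is open for the topology that the cylinder sets generate on the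
   groupoid if and only if it is open here, and the interiors agree as well. *)
HB.instance Definition _ G E (S : self_similar G E) :=
  isSubBaseTopological.Build (quad S) (@cylinders G E S) id.

Section Subgroupoids.
Variables (G : groupType) (E : digraph) (S : self_similar G E).
Implicit Types (H K : set (quad S)).

Definition Iso : set (quad S) := [set a | groupoid a /\ grng a = gsrc a].

Definition Iso_interior : set (quad S) := interior Iso.

Definition is_subgroupoid H : Prop :=
  (forall a b, H a -> H b -> composable a b -> H (gmul a b)) /\
  (forall a, H a -> H (ginv a)).

Definition is_abelian H : Prop :=
  forall a b, H a -> H b -> composable a b -> gmul a b = gmul b a.

Definition open_abelian_subgroupoid H : Prop :=
  [/\ H `<=` Iso_interior, is_subgroupoid H, open H & is_abelian H].

Definition maximal_open_abelian_subgroupoid H : Prop :=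
  open_abelian_subgroupoid H /\
  forall K, open_abelian_subgroupoid K -> H `<=` K -> K = H.

Definition cycline m g n : Prop :=
  psrc m = vact S g (psrc n) /\
  forall x, irng x = psrc n -> icat m (iact S g x) = icat n x.

Definition S_sym : set (quad S) :=
  [set a : quad S | exists m g, cycline m g m /\ cylinder m g m a].

End Subgroupoids.

Arguments S_sym {G E} S.

(* The infinite cyclic group <a>, written multiplicatively: its product is the
   addition of integers. *)
Definition mulZ : groupType := Algebra.to_multiplicative int.
Definition genZ : mulZ := 1%:Z%R.

Definition least_fixing_exponent (E : digraph) (S : self_similar mulZ E)
    (C : finpath E) (p : nat) : Prop :=
  let fixes q := exists2 v, vertex_on C v & vact S (genZ ^+ q) v = v in
  [/\ (0 < p)%N, fixes p & forall q, (0 < q)%N -> fixes q -> (p <= q)%N].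

(* Main.v *)
Require Import Defs.
From mathcomp Require Import all_boot all_order all_algebra.
From mathcomp Require Import boolp classical_sets topology.
From mathcomp Require Import finmap.

Set Implicit Arguments.
Unset Strict Implicit.
Unset Printing Implicit Defensive.

Import Order.TTheory GRing.Theory Num.Theory.

Local Open Scope classical_set_scope.
Local Open Scope quotient_scope.
Local Open Scope group_scope.

(** An element of the groupoid is determined by its two infinite paths, its
    cocycle and its degree.  If an element [a] lies in a cylinder, then for all
    large [p] it lies in the smaller cylinder built from the segment of length
    [p] of its left path, the value at [p] of its cocycle and the segment of
    length [p - qdegree a] of its right path.  So these canonical cylinders
    form a neighbourhood basis at [a] (lemma [germ_cylinder_nbhs]), and an open
    set of isotropy elements is a union of cylinders of cycline triples.

    The set [S_sym S] is open by definition.  Two of its composable elements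
    live over one infinite path [z], and refinement to a common level turns the
    groupoid product into the product of two group elements that act trivially
    on all infinite paths from a vertex of [z].  Hence it is a subgroupoid, and
    it inherits commutativity from the integers.

    For maximality let [K] be an open abelian subgroupoid that contains
    [S_sym S].  An element of [K] of degree 0 has a canonical cylinder with equal left
    and right paths, so it lies in [S_sym S].  As [K] is closed under
    inversion, it remains to exclude positive degrees ([isotropy_degree_le0]).
    Let (m, g, n) be a cycline triple with [plen m - plen n = k > 0] whose
    cylinder lies in [K].
    - For each infinite path [x] from the source of [n], the first [k] edges
      are prescribed by [m] and the rest of [x] is the translate of [x] by [g].
      This determines [x], so there is one such path only ([cycline_unique]).
    - The [j]-th multiple of [k] is a position on [x] whose vertex is the image
      of the first vertex under the [j]-th iterate of [g].  There are finitely
      many vertices, so [x] is periodic ([ishift_period]) and runs around a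
      cycle [C] whose length is a multiple of [k].  It has no entrance because
      every entrance would yield a second path.
    - Let [p] be the least exponent such that the [p]-th power of the generator
      fixes a vertex on [C].  This power fixes [x], so it gives an element of
      [S_sym S].  Since that element commutes with the one of degree [k], its
      restrictions along [x] are eventually [k]-periodic ([commute_irst]).
    - After many turns around [C] the restriction is therefore an integer [d]
      whose own restriction to [C] is [d].  It is nonzero by pseudo-freeness and a
      multiple of [p] by minimality of [p].  As restriction to [C] is additive
      on the stabilizer of [C] and the integers are torsion free, the [p]-th
      power itself restricts to itself on [C] ([rst_cycle_eventually]), which
      the hypothesis on cycles excludes. *)

(** * Infinite paths and the action on them *)

Section InfinitePaths.
Variable E : digraph.
Implicit Types (m t : finpath E) (x y z : infpath E) (v : vertex E).

Fact ishift_subproof i x j : esrc (x (i + j)%N) = erng (x (i + j.+1)%N).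
Proof. by rewrite addnS iedgeP. Qed.

Definition ishift i x : infpath E := InfPath (ishift_subproof i x).

Lemma ishift_edge i x j : ishift i x j = x (i + j)%N.
Proof. by []. Qed.

Lemma ishift0 x : ishift 0 x = x.
Proof. exact: infpath_eq. Qed.

Lemma ishiftD i j x : ishift i (ishift j x) = ishift (j + i) x.
Proof. by apply: infpath_eq => k /=; rewrite addnA. Qed.

Lemma irng_ishift i x : irng (ishift i x) = erng (x i).
Proof. by rewrite /irng /= addn0. Qed.

Lemma iseg_ishift i x p q : iseg (ishift i x) p q = iseg x (i + p) (i + q).
Proof.
apply: finpath_eq => //=; rewrite subnDl.
by apply: eq_map => j; rewrite addnA.
Qed.

Lemma plen_iseg x p q : plen (iseg x p q) = (q - p)%N.
Proof. by rewrite /plen size_mkseq. Qed.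

Lemma iseg_id x n : iseg x n n = vpath (erng (x n)).
Proof. by apply: finpath_eq => //=; rewrite subnn. Qed.

Lemma nth_iseg e x n i : (i < n)%N -> nth e (pedges (iseg x 0 n)) i = x i.
Proof. by move=> lt_in; rewrite /= subn0 nth_mkseq. Qed.

Lemma infpath_isegP x y : (forall n, iseg x 0 n = iseg y 0 n) -> x = y.
Proof.
move=> xy; apply: infpath_eq => i.
by rewrite -(nth_iseg (x i) x (ltnSn i)) xy nth_iseg.
Qed.

Lemma prng_pcat m t : psrc m = prng t -> prng (pcat m t) = prng m.
Proof. by rewrite /pcat; case: eqP. Qed.

Lemma pedges_pcat m t :
  psrc m = prng t -> pedges (pcat m t) = pedges m ++ pedges t.
Proof. by rewrite /pcat; case: eqP. Qed.

Lemma plen_pcat m t : psrc m = prng t -> plen (pcat m t) = (plen m + plen t)%N.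
Proof. by move=> mt; rewrite /plen pedges_pcat // size_cat. Qed.

Lemma psrc_pcat m t : psrc m = prng t -> psrc (pcat m t) = psrc t.
Proof.
move=> mt; rewrite /psrc prng_pcat // pedges_pcat // map_cat last_cat.
by rewrite -/(psrc m) mt.
Qed.

Lemma icatE m x i : psrc m = irng x ->
  icat m x i = nth (x (i - plen m)%N) (pedges m) i.
Proof. by rewrite /icat; case: eqP. Qed.

Lemma irng_icat m x : psrc m = irng x -> irng (icat m x) = prng m.
Proof.
move=> mx; rewrite /irng icatE //; case: m mx => v [|e s] //= /andP[/eqP-> _] //.
Qed.

Lemma iseg_icat m x : psrc m = irng x -> iseg (icat m x) 0 (plen m) = m.
Proof.
move=> mx; apply: finpath_eq; first exact: irng_icat.
rewrite /= subn0; apply: (@eq_from_nth _ (x 0%N)); rewrite size_mkseq // => i lti.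
by rewrite nth_mkseq // icatE //; apply: set_nth_default.
Qed.

Lemma ishift_icat m x : psrc m = irng x -> ishift (plen m) (icat m x) = x.
Proof.
move=> mx; apply: infpath_eq => i /=.
by rewrite icatE // nth_default ?leq_addr // addKn.
Qed.

Lemma psrc_iseg0 x n : psrc (iseg x 0 n) = irng (ishift n x).
Proof. by rewrite psrc_iseg // irng_ishift. Qed.

Lemma icat_ishift n x : icat (iseg x 0 n) (ishift n x) = x.
Proof.
apply: infpath_eq => i; rewrite icatE ?psrc_iseg0 // plen_iseg subn0.
have [lt_in|le_ni] := ltnP i n; first exact: nth_iseg.
by rewrite nth_default /= ?size_mkseq ?subn0 // subnKC.
Qed.

Lemma icat_pcat m t x : psrc m = prng t -> psrc t = irng x ->
  icat (pcat m t) x = icat m (icat t x).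
Proof.
move=> mt tx; apply: infpath_eq => i.
rewrite icatE ?psrc_pcat // icatE ?irng_icat // icatE //.
rewrite pedges_pcat // plen_pcat // nth_cat subnDA.
have [lt_im|le_mi] := ltnP; first exact: set_nth_default.
by rewrite [RHS]nth_default.
Qed.

(** Without sources, an edge is extended backwards indefinitely; entrances to a
    path thus yield further infinite paths. *)
Lemma infpath_from_edge (e : edge E) : source_free E ->
  exists x, x 0%N = e.
Proof.
move=> sf.
have ex v : exists f : edge E, erng f == v by have [f <-] := sf v; exists f.
pose pre v := xchoose (ex v).
have preP v : erng (pre v) = v by apply/eqP/(xchooseP (ex v)).
pose f i := iter i (fun e' => pre (esrc e')) e.
have fP i : esrc (f i) = erng (f i.+1) by rewrite preP.
by exists (InfPath fP).
Qed.

End InfinitePaths.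

Section ActionOnInfinitePaths.
Variables (G : groupType) (E : digraph) (S : self_similar G E).
Implicit Types (m t : finpath E) (x y z : infpath E) (v : vertex E) (g h : G).

Lemma psrc_actE g m : psrc (act S g m) = vact S g (psrc m).
Proof. exact: (congr1 (@prng E) (psrc_act S g m)). Qed.

Lemma prng_actE g m : prng (act S g m) = vact S g (prng m).
Proof. exact: (congr1 (@prng E) (prng_act S g m)). Qed.

(** Since sources are equivariant, [g] and its restriction to [m] agree on the
    source of [m]. *)
Lemma vact_rst g m : vact S (rst S g m) (psrc m) = vact S g (psrc m).
Proof.
have [|] := act_pcat S g (m := m) (n := vpath (psrc m)); first by [].
by rewrite psrc_actE prng_actE.
Qed.

Lemma vact1 v : vact S 1 v = v.
Proof. by rewrite /vact act1. Qed.

Lemma vactM g h v : vact S (g * h) v = vact S g (vact S h v).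
Proof. by rewrite {1}/vact actM -prng_actE. Qed.

Lemma vactK g : cancel (vact S g) (vact S g^-1).
Proof. by move=> v; rewrite -vactM mulVg vact1. Qed.

Lemma rstV g m : rst S g^-1 (act S g m) = (rst S g m)^-1.
Proof.
apply: (mulIg (rst S g m)).
by rewrite mulVg -rstM mulVg rst1.
Qed.

Lemma iseg0_iact g x n : iseg (iact S g x) 0 n = act S g (iseg x 0 n).
Proof. by rewrite iseg_iact // iseg_id rst_vpath. Qed.

Lemma irng_iact g x : irng (iact S g x) = vact S g (irng x).
Proof.
have := congr1 (@prng E) (iseg0_iact g x 0); rewrite (iseg_id x); exact: id.
Qed.

Lemma ishift_iact g x n :
  ishift n (iact S g x) = iact S (rst S g (iseg x 0 n)) (ishift n x).
Proof.
apply: infpath_isegP => k.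
by rewrite iseg0_iact !iseg_ishift addn0 iseg_iact // leq_addr.
Qed.

Lemma erng_iact g x n : erng (iact S g x n) = vact S g (erng (x n)).
Proof.
by rewrite -irng_ishift ishift_iact irng_iact -psrc_iseg0 vact_rst psrc_iseg.
Qed.

Lemma iact_icat g t x : psrc t = irng x ->
  iact S g (icat t x) = icat (act S g t) (iact S (rst S g t) x).
Proof.
move=> tx; rewrite -[LHS](icat_ishift (plen t)) ishift_iact iseg0_iact.
by rewrite ishift_icat // iseg_icat.
Qed.

Lemma iact_fixP g x :
  iact S g x = x <-> forall n, act S g (iseg x 0 n) = iseg x 0 n.
Proof.
split=> [gx n|gx]; first by rewrite -iseg0_iact gx.
by apply: infpath_isegP => n; rewrite iseg0_iact.
Qed.

Lemma irst_ishift g x p q :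
  irst S g x (p + q) = irst S (irst S g x p) (ishift p x) q.
Proof.
rewrite /irst iseg_ishift addn0; apply: rst_iseg; exact: leq_addr.
Qed.

End ActionOnInfinitePaths.

(** * Cylinder sets as a basis of the topology *)

Section CylinderBasis.
Variables (G : groupType) (E : digraph) (S : self_similar G E).
Implicit Types (m n t : finpath E) (x y : infpath E) (g : G) (a : quad S).

Lemma tshift_nat k (f : nat -> G) p : tshift k%:Z f (k + p) = f p.
Proof.
by rewrite /tshift lez_nat leq_addr PoszD addrAC subrr add0r absz_nat.
Qed.

Lemma iseg_icatD m x q : psrc m = irng x ->
  iseg (icat m x) 0 (plen m + q) = pcat m (iseg x 0 q).
Proof.
move=> mx; rewrite (@iseg_cat _ _ 0 (plen m)) ?leq_addr // iseg_icat //.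
by rewrite -{1}(addn0 (plen m)) -iseg_ishift ishift_icat.
Qed.

(** An initial segment of the point [icat t y] may be moved into the two paths
    that define the cylinder. *)
Lemma cylinder_elt_refine m g n t y :
    psrc m = vact S g (psrc n) -> psrc n = prng t -> psrc t = irng y ->
  cylinder_elt S (pcat m (act S g t)) (rst S g t) (pcat n t) y =
  cylinder_elt S m g n (icat t y).
Proof.
move=> mgn nt ty.
have mgt : psrc m = prng (act S g t) by rewrite prng_actE -nt.
have gty : psrc (act S g t) = irng (iact S (rst S g t) y).
  by rewrite irng_iact -ty vact_rst psrc_actE.
rewrite /cylinder_elt iact_icat // !icat_pcat // !plen_pcat // plen_act.
congr Quad; last by rewrite !PoszD opprD addrACA subrr addr0.
rewrite !Tshift_pi; apply/eqP/Q_eqP; exists (plen m + plen t)%N => p.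
move/subnKC <-; rewrite tshift_nat -addnA tshift_nat irst_ishift.
by rewrite ishift_icat // /irst iseg_icat.
Qed.

Definition qpath_left a p : finpath E := iseg (qleft a) 0 p.
Definition qpath_right a p : finpath E :=
  iseg (qright a) 0 `|(p%:Z - qdegree a)%R|.

(** The value of the chosen representative of the cocycle at [p] depends on the
    choice, but not for large [p]. *)
Definition germ_cylinder a p : set (quad S) :=
  cylinder (qpath_left a p) (repr (qcocycle a) p) (qpath_right a p).

(** For [p >= plen m] the two canonical paths extend [m] and [n]; beyond the
    point where the representative of the cocycle agrees with the restrictions
    of [g], the canonical cylinder is a refinement of the given one. *)
Lemma germ_cylinderP m g n a :
    psrc m = vact S g (psrc n) -> cylinder m g n a ->
  exists N, forall p, (N <= p)%N ->
    [/\ psrc (qpath_left a p) =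
          vact S (repr (qcocycle a) p) (psrc (qpath_right a p)),
        germ_cylinder a p a & germ_cylinder a p `<=` cylinder m g n].
Proof.
move=> mgn [x /= xn <-]; set a' := cylinder_elt _ _ _ _ _.
have [N reprN] := repr_piQ (tshift (plen m)%:Z (irst S g x)).
exists (maxn N (plen m)) => p; rewrite geq_max => /andP[Np mp].
have mgx : psrc m = irng (iact S g x) by rewrite irng_iact xn.
pose t := iseg x 0 (p - plen m).
have nt : psrc n = prng t by rewrite -xn.
have mgt : psrc m = prng (act S g t) by rewrite prng_actE -nt.
have El : qpath_left a' p = pcat m (act S g t).
  by rewrite /qpath_left -(subnKC mp) iseg_icatD // iseg0_iact.
have Eg : repr (qcocycle a') p = rst S g t.
  by rewrite [qcocycle a']Tshift_pi reprN // -{1}(subnKC mp) tshift_nat.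
have Er : qpath_right a' p = pcat n t.
  rewrite /qpath_right /= -{1}(subnKC mp) PoszD opprB addrC addrA subrK.
  by rewrite -PoszD absz_nat iseg_icatD.
rewrite /germ_cylinder El Eg Er; split.
- by rewrite !psrc_pcat // vact_rst psrc_actE.
- exists (ishift (p - plen m) x); first by rewrite /= psrc_pcat // psrc_iseg0.
  by rewrite cylinder_elt_refine ?icat_ishift ?psrc_iseg0.
- move=> _ [y /= yt <-]; rewrite psrc_pcat // in yt.
  by rewrite cylinder_elt_refine //; exists (icat t y); rewrite //= irng_icat.
Qed.

Lemma quad_openE (O : set (quad S)) :
  open O =
  [set \bigcup_(U in B) U |
    B in subset^~ (finI_from (@cylinders G E S) id)] O.
Proof. by []. Qed.

(** A finite intersection of cylinders that contains [a] contains the canonical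
    cylinders of [a] that are deep enough for all of them. *)
Lemma germ_cylinder_nbhs (O : set (quad S)) a : open O -> O a -> groupoid a ->
  exists N, forall p, (N <= p)%N ->
    [/\ psrc (qpath_left a p) =
          vact S (repr (qcocycle a) p) (psrc (qpath_right a p)),
        germ_cylinder a p a & germ_cylinder a p `<=` O].
Proof.
rewrite quad_openE => -[B sB <-] [U BU Ua] [m [g [n [x [mgn xn ea]]]]].
have [D sD UD] := sB U BU.
have [|N HN] := germ_cylinderP (m := m) (g := g) (n := n) (a := a) mgn.
  by rewrite ea; exists x.
suff [M HM] : exists M, forall p, (M <= p)%N ->
    forall V, V \in enum_fset D -> germ_cylinder a p `<=` V.
  exists (maxn N M) => p; rewrite geq_max => /andP[/HN[? ? _] /HM sub].
  split=> // b gb; exists U => //; rewrite -UD => V VD; exact: sub gb.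
have sD' : forall V, V \in enum_fset D -> @cylinders G E S V.
  by move=> V VD; apply/set_mem/sD.
have Da : forall V, V \in enum_fset D -> V a.
  by move=> V VD; move: Ua; rewrite -UD; apply.
elim: (enum_fset D) sD' Da => [|V s IHs] sD' Da; first by exists 0%N.
have [|V' Vs|M HM] := IHs _ _.
- by move=> W Ws; apply: sD'; rewrite inE Ws orbT.
- by apply: Da; rewrite inE Vs orbT.
have [m' [g' [n' [mgn' EV]]]] := sD' V (mem_head _ _).
have [|M' HM'] := germ_cylinderP (m := m') (g := g') (n := n') (a := a) mgn'.
  by rewrite -EV; apply: Da; exact: mem_head.
exists (maxn M M') => p; rewrite geq_max => /andP[/HM sub /HM'[_ _ sub']] W.
by rewrite inE => /orP[/eqP->|/sub//]; rewrite EV.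
Qed.

Lemma cylinder_open m g n :
  psrc m = vact S g (psrc n) -> open (cylinder m g n : set (quad S)).
Proof.
move=> mgn; set U := cylinder _ _ _; rewrite quad_openE.
exists [set U]; last by rewrite bigcup_set1.
move=> _ ->; exists (fset1 U); last by rewrite set_fset1 bigcap_set1.
by move=> V; rewrite inE => /eqP->; apply/mem_set; exists m, g, n.
Qed.

End CylinderBasis.

(** * The subgroupoid of symmetric cycline triples *)

Section SymmetricPart.
Variables (G : groupType) (E : digraph) (S : self_similar G E).
Implicit Types (m t : finpath E) (x y z : infpath E) (g h : G) (a b : quad S).
Implicit Types (k j : nat).

Definition fixes_paths g v : Prop := forall x, irng x = v -> iact S g x = x.

Lemma cycline_sym m g : psrc m = vact S g (psrc m) ->
  cycline S m g m <-> fixes_paths g (psrc m).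
Proof.
move=> gm; split=> [[_ mg] x xm|gx]; last by split=> // x xm; rewrite gx.
rewrite -[LHS](ishift_icat (m := m)) ?irng_iact ?xm // mg // ishift_icat //.
Qed.

(** The form of the elements of [S_sym S], parametrized by the underlying path
    [z] rather than by a decomposition of [z], so that two elements over [z]
    can be compared. *)
Definition sym_elt k g z : quad S :=
  Quad S z (Tshift k%:Z (\pi_(Q G) (irst S g (ishift k z)))) 0%R z.

Lemma S_symP a : S_sym S a <->
  exists k g z, fixes_paths g (irng (ishift k z)) /\ a = sym_elt k g z.
Proof.
split=> [[m [g [[gm mg] [x /= xm <-]]]]|[k [g [z [gz ->]]]]].
  exists (plen m), g, (icat m x); rewrite /sym_elt ishift_icat // xm; split.
    by apply/(cycline_sym gm).
  by rewrite /cylinder_elt mg // subrr.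
have gk : psrc (iseg z 0 k) = vact S g (psrc (iseg z 0 k)).
  by rewrite psrc_iseg0 -irng_iact gz.
exists (iseg z 0 k), g; split.
  by apply/(cycline_sym gk); rewrite psrc_iseg0.
exists (ishift k z); first by rewrite /= psrc_iseg0.
by rewrite /cylinder_elt gz // icat_ishift plen_iseg subn0 subrr.
Qed.

Lemma fixes_paths_rst g x j : fixes_paths g (irng x) ->
  fixes_paths (irst S g x j) (irng (ishift j x)).
Proof.
move=> gx y yx; rewrite /irst; set t := iseg x 0 j.
have ty : psrc t = irng y by rewrite psrc_iseg0.
have gty : iact S g (icat t y) = icat t y by apply: gx; rewrite irng_icat.
by have := ishift_iact S g (icat t y) (plen t);
  rewrite gty ishift_icat ?iseg_icat.
Qed.

Lemma sym_elt_refine k j g z :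
  sym_elt (k + j) (irst S g (ishift k z) j) z = sym_elt k g z.
Proof.
rewrite /sym_elt !Tshift_pi; congr Quad.
apply/eqP/Q_eqP; exists (k + j)%N => p /subnKC <-.
by rewrite tshift_nat -addnA tshift_nat irst_ishift ishiftD.
Qed.

Lemma Tshift0 (q : Q G) : Tshift 0%R q = q.
Proof.
elim/quotW: q => f; rewrite Tshift_pi; apply: eq_piQ => p.
exact: (tshift_nat 0 f p).
Qed.

Lemma sym_eltM k g h z : fixes_paths h (irng (ishift k z)) ->
  gmul (sym_elt k g z) (sym_elt k h z) = sym_elt k (g * h) z.
Proof.
move=> hz; rewrite /gmul /= addr0; congr Quad.
rewrite Tshift0 !Tshift_pi [LHS]Qmul_pi; apply: eq_piQ => p.
rewrite /tshift; case: ifP => _; last by rewrite mulg1.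
have /iact_fixP hp := hz _ erefl.
by rewrite /irst rstM hp.
Qed.

Lemma sym_eltV k g z : fixes_paths g (irng (ishift k z)) ->
  ginv (sym_elt k g z) = sym_elt k g^-1 z.
Proof.
move=> gz; rewrite /ginv /sym_elt /= oppr0 Tshift0 !Tshift_pi; congr Quad.
rewrite [LHS]Qinv_pi; apply: eq_piQ => p.
rewrite /tshift; case: ifP => _; last by rewrite invg1.
have /iact_fixP gp := gz _ erefl.
by rewrite /irst -[in RHS]gp rstV.
Qed.

Lemma composable_qright a b : composable a b -> qright a = qleft b.
Proof. by case. Qed.

Lemma S_sym_subgroupoid : is_subgroupoid (S_sym S).
Proof.
split=> [a b|a].
  move=> /S_symP[k [g [z [gz ->]]]] /S_symP[j [h [w [hw ->]]]].
  move=> /composable_qright /= zw; subst w.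
  (* Both factors are refined to the common level k + j. *)
  rewrite -(sym_elt_refine k j) -(sym_elt_refine j k) [(j + k)%N]addnC.
  have hz := fixes_paths_rst (j := k) hw.
  rewrite ishiftD addnC in hz.
  rewrite sym_eltM //; apply/S_symP; eexists _, _, _; split; last reflexivity.
  move=> x xz; apply/iact_fixP => n; rewrite actM.
  have /iact_fixP-> := hz _ xz.
  by move: n; apply/iact_fixP; apply: fixes_paths_rst => //; rewrite ishiftD.
move=> /S_symP[k [g [z [gz ->]]]]; rewrite sym_eltV //.
apply/S_symP; exists k, g^-1, z; split=> // x xz; apply/iact_fixP => n.
have /iact_fixP gx := gz _ xz.
by rewrite -{1}gx -actM mulVg act1.
Qed.

Lemma S_sym_abelian : (forall g h, g * h = h * g) -> is_abelian (S_sym S).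
Proof.
move=> GC a b /S_symP[k [g [z [_ ->]]]] /S_symP[j [h [w [_ ->]]]].
move=> /composable_qright /= <-; rewrite /gmul /= !Tshift0.
congr Quad; elim/quotW: (Tshift _ _) => f; elim/quotW: (Tshift _ _) => f'.
by rewrite [LHS]Qmul_pi [RHS]Qmul_pi; apply: eq_piQ => p; exact: GC.
Qed.

Lemma S_sym_open : open (S_sym S).
Proof.
rewrite openE => a [m [g [mg ma]]].
have om : open (cylinder m g m : set (quad S)).
  by apply: cylinder_open; case: mg.
suff: cylinder m g m `<=` interior (S_sym S) by apply.
rewrite -(open_subsetE _ om) => b mb; by exists m; exists g.
Qed.

Lemma S_sym_Iso_interior : S_sym S `<=` @Iso_interior G E S.
Proof.
rewrite /Iso_interior -(open_subsetE _ S_sym_open) => _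
  [m [g [[gm mg] [x /= xm <-]]]].
by split; [exists m, g, m, x | rewrite /grng /gsrc /= mg].
Qed.

End SymmetricPart.

(** * Cycline triples of positive degree and periodic paths *)

Section UniqueInfinitePath.
Variables (G : groupType) (E : digraph) (S : self_similar G E).
Implicit Types (x y : infpath E) (g h : G).
Implicit Types (v : vertex E) (e : edge E).

Definition unique_from v : Prop :=
  forall x y, irng x = v -> irng y = v -> x = y.

(** A tail is as unique as the whole path, since a second tail could be glued
    to the same initial segment. *)
Lemma unique_from_ishift x i :
  unique_from (irng x) -> unique_from (irng (ishift i x)).
Proof.
move=> ux.
have tail y : irng y = irng (ishift i x) -> y = ishift i x.
  move=> yx; have xy : psrc (iseg x 0 i) = irng y by rewrite psrc_iseg0.
  have -> : x = icat (iseg x 0 i) y by apply: ux; rewrite ?irng_icat.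
  by rewrite -{1}(subn0 i) -(plen_iseg x 0 i) ishift_icat.
by move=> y z /tail-> /tail->.
Qed.

Lemma unique_fixed h x :
  unique_from (irng x) -> vact S h (irng x) = irng x -> iact S h x = x.
Proof. by move=> ux hx; apply: ux; rewrite // irng_iact. Qed.

Lemma vact_inj g : injective (vact S g).
Proof. exact: can_inj (vactK S g). Qed.

Lemma eq_iseg_tail x y p q : (p < q)%N ->
  iseg x 0 q = iseg y 0 q -> iseg x p q = iseg y p q.
Proof.
move=> lt_pq xy.
have xyi i : (i < q)%N -> x i = y i.
  by move=> iq; rewrite -(nth_iseg (x 0%N) x iq) xy nth_iseg.
apply: finpath_eq; first by rewrite /= xyi.
rewrite /= /mkseq; apply/eq_in_map => i; rewrite mem_iota add0n => /andP[_ ip].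
by rewrite xyi // -ltn_subRL.
Qed.

Lemma cycline_ishift m g n x : cycline S m g n -> (plen n < plen m)%N ->
  irng x = psrc n -> ishift (plen m - plen n) x = iact S g x.
Proof.
move=> [mgn cyc] lt_nm xn.
have mgx : psrc m = irng (iact S g x) by rewrite irng_iact xn.
rewrite -(ishift_icat mgx) cyc // -{1}(ishift_icat (esym xn)) ishiftD.
by rewrite subnKC // ltnW.
Qed.

(** The length on which two infinite paths from the source of [n] agree grows
    by [plen m - plen n]: both begin with the same segment of [m] and continue
    with their own translates by [g]. *)
Lemma cycline_unique m g n : cycline S m g n -> (plen n < plen m)%N ->
  unique_from (psrc n).
Proof.
move=> mgn lt_nm x y xn yn; pose k := (plen m - plen n)%N.
have k_gt0 : (0 < k)%N by rewrite subn_gt0.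
have sx := cycline_ishift mgn lt_nm xn; have sy := cycline_ishift mgn lt_nm yn.
case: mgn => mgn cyc.
have seg z : irng z = psrc n ->
    iseg z 0 k = iseg (icat m (iact S g z)) (plen n) (plen m).
  move=> zn; rewrite cyc // -{1}(ishift_icat (esym zn)) iseg_ishift addn0.
  by rewrite subnKC // ltnW.
have segk : iseg x 0 k = iseg y 0 k.
  rewrite !seg //; apply: eq_iseg_tail => //.
  by rewrite !iseg_icat // irng_iact ?xn ?yn.
have step j : iseg x 0 (j * k) = iseg y 0 (j * k).
  elim: j => [|j IHj]; first by
    rewrite mul0n !iseg_id -/(irng x) -/(irng y) xn yn.
  have dec z :
    iseg z 0 (j.+1 * k) = pcat (iseg z 0 k) (iseg (ishift k z) 0 (j * k)).
    by rewrite iseg_ishift addn0 -mulSn; apply: iseg_cat; rewrite mulSn leq_addr.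
  by rewrite !dec sx sy !iseg0_iact IHj segk.
apply: infpath_eq => i.
have lt_i : (i < i.+1 * k)%N by rewrite leq_pmulr.
by rewrite -(nth_iseg (x 0%N) x lt_i) step nth_iseg.
Qed.

(** Sources are equivariant, so the vertices of the translate of [x] by [g] are
    the images under [g] itself, not under its restrictions. *)
Lemma erng_iter g k x j : ishift k x = iact S g x ->
  erng (x (j * k)%N) = iter j (vact S g) (irng x).
Proof.
move=> kx; elim: j => [|j IHj] //.
by rewrite mulSn -ishift_edge kx erng_iact IHj.
Qed.

(** The vertex map of [g] permutes a finite set, so the orbit of the first
    vertex returns to it; uniqueness turns the return of a vertex into a
    period. *)
Lemma ishift_period g k x : unique_from (irng x) -> ishift k x = iact S g x ->
  exists2 j, (0 < j)%N & ishift (j * k) x = x.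
Proof.
move=> ux kx; exists (order (vact S g) (irng x)); first exact: order_gt0.
apply: ux; rewrite ?irng_ishift // (erng_iter _ kx).
exact: (iter_order (@vact_inj g)).
Qed.

Lemma ishift_mul n x j : ishift n x = x -> ishift (j * n) x = x.
Proof.
by move=> nx; elim: j => [|j IHj]; rewrite ?ishift0 // mulSn -ishiftD nx.
Qed.

Section PeriodicPath.
Variables (x : infpath E) (n : nat).
Hypotheses (n_gt0 : (0 < n)%N) (x_per : ishift n x = x).
Hypothesis (ux : unique_from (irng x)).

Lemma periodic_is_cycle : is_cycle (iseg x 0 n).
Proof. by rewrite /is_cycle plen_iseg subn0 psrc_iseg0 x_per. Qed.

Lemma mem_pedges_period e :
  e \in pedges (iseg x 0 n) -> exists2 i, (i < n)%N & e = x i.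
Proof.
case/(nthP e) => i; rewrite -/(plen _) plen_iseg subn0 => lt_in.
by rewrite nth_iseg // => <-; exists i.
Qed.

Lemma vertex_on_cycle : vertex_on (iseg x 0 n) (irng x).
Proof.
exists (x 0%N) => //; rewrite -(nth_iseg (x 0%N) x n_gt0) mem_nth //.
by rewrite -/(plen _) plen_iseg subn0.
Qed.

(** An entrance would be the first edge of a second infinite path. *)
Lemma unique_no_entrance : source_free E -> no_entrance (iseg x 0 n).
Proof.
move=> sf e f /mem_pedges_period[i _ ->] fi.
have [y yf] := infpath_from_edge f sf.
have yx : y = ishift i x.
  apply: (unique_from_ishift (i := i) ux) => //.
  by rewrite irng_ishift -fi /irng yf.
by rewrite -yf yx ishift_edge addn0.
Qed.

(** A group element that fixes one vertex of a cycle without entrance fixes the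
    infinite path from there, hence the whole cycle. *)
Lemma vact_cycle h v : vertex_on (iseg x 0 n) v ->
  vact S h v = v -> vact S h (irng x) = irng x.
Proof.
move=> [e /mem_pedges_period[i lt_in ->] ->]; rewrite -irng_ishift => hi.
have := erng_iact S h (ishift i x) (n - i).
rewrite (unique_fixed (unique_from_ishift ux) hi) ishift_edge subnKC 1?ltnW //.
by rewrite -(irng_ishift n) x_per.
Qed.

End PeriodicPath.
End UniqueInfinitePath.

(** * Actions of the integers *)

Section IntegerAction.
Variables (E : digraph) (S : self_similar mulZ E).
Implicit Types (x : infpath E) (v : vertex E) (d h : mulZ).

Lemma mulZ_expg d i : d ^+ i = ((d : int) * i%:Z)%R.
Proof.
elim: i => [|i IHi]; first by rewrite mulr0.
by rewrite expgS -[i.+1]add1n PoszD mulrDr mulr1 -IHi.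
Qed.

Lemma mulZ_expgI d h i : (0 < i)%N -> d ^+ i = h ^+ i -> d = h.
Proof.
move=> i_gt0; rewrite !mulZ_expg; apply: mulIf.
by case: i i_gt0.
Qed.

Lemma mulZC d h : d * h = h * d.
Proof. exact: addrC. Qed.

Lemma genZ_expg i : genZ ^+ i = Posz i.
Proof. by rewrite mulZ_expg mul1r. Qed.

Lemma vact_genZ_expg i v : vact S (genZ ^+ i) v = iter i (vact S genZ) v.
Proof. by elim: i => [|i IHi]; rewrite ?vact1 // expgS vactM IHi. Qed.

Lemma vact_genZ_modn p D v : vact S (genZ ^+ p) v = v ->
  vact S (genZ ^+ (D %% p)) v = vact S (genZ ^+ D) v.
Proof.
move=> pv; rewrite {2}(divn_eq D p) addnC expgnDr vactM mulnC expgnA.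
congr (vact S _ _); elim: (D %/ p) => [|c IHc]; first by rewrite vact1.
by rewrite expgS vactM -IHc pv.
Qed.

(** A power of [genZ] that fixes some vertex of the cycle fixes [irng x].  So the
    least exponent for the whole cycle is the least one for [irng x], where
    division with remainder applies. *)
Lemma least_fixing_exponent_cycle x n : unique_from (irng x) ->
    (0 < n)%N -> ishift n x = x ->
  exists p, [/\ least_fixing_exponent S (iseg x 0 n) p,
    vact S (genZ ^+ p) (irng x) = irng x &
    forall D, vact S (genZ ^+ D) (irng x) = irng x -> p %| D].
Proof.
move=> ux n_gt0 x_per; set v := irng x.
have ex : exists p, (0 < p)%N && (vact S (genZ ^+ p) v == v).
  exists (order (vact S genZ) v).
  rewrite order_gt0 vact_genZ_expg; apply/eqP/iter_order/vact_inj.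
have [p /andP[p_gt0 /eqP pv] p_min] := ex_minnP ex.
exists p; split=> //.
- split=> //; first by exists v => //; exact: vertex_on_cycle.
  move=> q q_gt0 [w wC qw]; apply: p_min; rewrite q_gt0.
  by apply/eqP; exact: vact_cycle wC qw.
- move=> D; rewrite -(vact_genZ_modn D pv) /dvdn => Dv.
  apply: contraTT (ltn_pmod D p_gt0); rewrite -leqNgt -lt0n => D_gt0.
  by apply: p_min; rewrite D_gt0 Dv eqxx.
Qed.

(** Restriction to [m] is a homomorphism on the stabilizer of [m]. *)
Lemma rst_fixed_expg h m c : act S h m = m -> rst S (h ^+ c) m = rst S h m ^+ c.
Proof.
move=> hm; elim: c => [|c IHc]; first by rewrite rst1.
rewrite !expgS rstM IHc; congr (rst S h _ * _).
by elim: c {IHc} => [|c IHc]; rewrite ?act1 // expgS actM IHc.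
Qed.

(** If the restrictions of a power of the generator along a path around a cycle
    are eventually the same after each turn, then one of them, [d], restricts to itself on the
    cycle.  Some power of the original element is [d] or its inverse, and roots
    in the integers are unique, so the original element restricts to itself as
    well. *)
Lemma rst_cycle_eventually x n p N :
    pseudo_free S -> unique_from (irng x) ->
    (0 < n)%N -> ishift n x = x -> (0 < p)%N ->
    vact S (genZ ^+ p) (irng x) = irng x ->
    (forall D, vact S (genZ ^+ D) (irng x) = irng x -> p %| D) ->
    (forall i, (N <= i)%N ->
      irst S (genZ ^+ p) x (i + n) = irst S (genZ ^+ p) x i) ->
  rst S (genZ ^+ p) (iseg x 0 n) = genZ ^+ p.
Proof.
move=> pf ux n_gt0 x_per p_gt0 pv p_dvd ev.
have fixC h : vact S h (irng x) = irng x -> act S h (iseg x 0 n) = iseg x 0 n.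
  by move=> hv; rewrite -iseg0_iact unique_fixed.
(* The position N * n is a whole number of turns and is at least N. *)
pose i := (N * n)%N; pose d := irst S (genZ ^+ p) x i.
have i_per : ishift i x = x by exact: ishift_mul.
have px := unique_fixed ux pv.
have dv : vact S d (irng x) = irng x.
  have := vact_rst S (genZ ^+ p) (iseg x 0 i).
  by rewrite psrc_iseg0 i_per pv.
have dC : rst S d (iseg x 0 n) = d.
  by have := ev i (leq_pmulr _ n_gt0); rewrite irst_ishift i_per.
have d_neq1 : d <> 1.
  move=> d1; have /(pf _ _) := d1; rewrite -iseg0_iact px => /(_ erefl) p1.
  by move: p_gt0; have := genZ_expg p; rewrite p1 => -[<-].
(* Passing from d to its inverse makes the exponent a natural number. *)
pose D := `|d : int|%N.
have [Dv DC] : vact S (genZ ^+ D) (irng x) = irng x /\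
               rst S (genZ ^+ D) (iseg x 0 n) = genZ ^+ D.
  have [d_ge0|d_le0] := leP 0%R (d : int).
    by have -> : genZ ^+ D = d by rewrite genZ_expg gez0_abs.
  have -> : genZ ^+ D = d^-1 by rewrite genZ_expg ltz0_abs.
  split; first by rewrite -{1}dv vactK.
  by rewrite -{1}(fixC _ dv) rstV dC.
have [c Dcp] := dvdnP (p_dvd _ Dv).
have c_gt0 : (0 < c)%N.
  rewrite lt0n; apply/eqP => c0; apply: d_neq1; apply/eqP.
  by rewrite -absz_eq0 -/D Dcp c0.
move: DC; rewrite Dcp mulnC expgnA.
rewrite (rst_fixed_expg c (fixC _ pv)).
exact: mulZ_expgI c_gt0.
Qed.

(** In a product, the degree of the left factor shifts the cocycle of the right
    one.  The group being commutative, the cocycle of the first element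
    cancels, and what remains compares the restrictions of [h] with a shift of
    themselves. *)
Lemma commute_irst m g n x h :
    (plen n <= plen m)%N ->
    gmul (cylinder_elt S m g n x) (cylinder_elt S n h n x) =
    gmul (cylinder_elt S n h n x) (cylinder_elt S m g n x) ->
  exists N, forall i, (N <= i)%N ->
    irst S h x (plen m - plen n + i) = irst S h x i.
Proof.
move=> le_nm /(congr1 (@qcocycle _ _ S)) /=.
rewrite subrr Tshift0 subzn // !(Tshift_pi (plen _)%:Z (irst _ _ _)) Tshift_pi
  [LHS]Qmul_pi [RHS]Qmul_pi.
move=> /eqP/Q_eqP[N HN]; exists N => i Ni; set k := (plen m - plen n)%N.
have /HN : (N <= plen n + (k + i))%N.
  by rewrite !addnA; apply/(leq_trans Ni)/leq_addl.
rewrite [LHS]mulZC tshift_nat addnCA !tshift_nat.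
by move=> /mulIg.
Qed.

(** An element of positive degree would force a cycle without entrance on which
    the restriction of the minimal fixing power is that power itself. *)
Lemma isotropy_degree_le0 (K : set (quad S)) a :
  source_free E -> pseudo_free S ->
  (forall (C : finpath E) (p : nat),
     is_cycle C -> no_entrance C -> least_fixing_exponent S C p ->
     rst S (genZ ^+ p) C <> genZ ^+ p) ->
  open_abelian_subgroupoid K -> S_sym S `<=` K -> K a -> (qdegree a <= 0)%R.
Proof.
move=> sf pf hyp [KI _ Ko Kab] SK Ka; rewrite leNgt; apply/negP => deg_gt0.
have KIso b : K b -> Iso b by move=> /KI/interior_subset.
have [gr_a _] := KIso _ Ka.
have [N /(_ N (leqnn N))[mgn [x /= xn ea] sub]] :=
  germ_cylinder_nbhs Ko Ka gr_a.
rewrite /germ_cylinder in sub.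
move: (qpath_left a N) (repr _ N) (qpath_right a N) mgn xn ea sub.
move=> m g n mgn xn ea sub.
have cyc : cycline S m g n.
  split=> // y yn; have /sub/KIso[_] : cylinder m g n (cylinder_elt S m g n y).
    by exists y.
  by case.
have lt_nm : (plen n < plen m)%N by rewrite -ea /= subr_gt0 in deg_gt0.
have ux : unique_from (irng x) by rewrite xn; exact: cycline_unique cyc lt_nm.
have gx := cycline_ishift cyc lt_nm xn.
set k := (plen m - plen n)%N in gx.
have [j j_gt0 x_per] := ishift_period ux gx.
have k_gt0 : (0 < k)%N by rewrite subn_gt0.
have jk_gt0 : (0 < j * k)%N by rewrite muln_gt0 j_gt0.
have [p [p_least pv p_dvd]] := least_fixing_exponent_cycle ux jk_gt0 x_per.
have rst_neq := hyp _ p (periodic_is_cycle jk_gt0 x_per)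
  (unique_no_entrance ux sf) p_least.
case: p_least => p_gt0 _ _; apply: rst_neq.
have px : fixes_paths S (genZ ^+ p) (psrc n).
  by move=> y yn; apply: unique_fixed; rewrite yn -xn.
have pn : psrc n = vact S (genZ ^+ p) (psrc n) by rewrite -xn pv.
pose b := cylinder_elt S n (genZ ^+ p) n x.
have Kb : K b.
  apply: SK; exists n; exists (genZ ^+ p); split; first exact/(cycline_sym pn).
  by exists x.
have ab : composable a b.
  by rewrite -ea /composable /gsrc /grng /= px.
have := Kab _ _ Ka Kb ab; rewrite -ea => /(commute_irst (ltnW lt_nm))[M HM].
apply: (rst_cycle_eventually (N := M)) => // i Mi.
elim: j {j_gt0 x_per jk_gt0} => [|j IHj]; first by rewrite addn0.
by rewrite mulSn addnCA HM // (leq_trans Mi) ?leq_addr.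
Qed.

End IntegerAction.

Theorem theorem5p4 (E : digraph) (S : self_similar mulZ E) :
  source_free E ->
  pseudo_free S ->
  (forall (C : finpath E) (p : nat),
     is_cycle C -> no_entrance C -> least_fixing_exponent S C p ->
     rst S (genZ ^+ p) C <> genZ ^+ p /\ rst S (genZ ^+ p) C <> genZ ^- p) ->
  maximal_open_abelian_subgroupoid (S_sym S).
Proof.
move=> sf pf hyp.
have hyp1 C p cC nC pC := (hyp C p cC nC pC).1; split.
  split; [exact: S_sym_Iso_interior | exact: S_sym_subgroupoid |
          exact: S_sym_open | exact/S_sym_abelian/mulZC].
move=> K Kopen SK; apply/seteqP; split=> // a Ka.
have deg0 : qdegree a = 0%R.
  have [_ [_ KV] _ _] := Kopen.
  have := isotropy_degree_le0 sf pf hyp1 Kopen SK (KV _ Ka).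
  have := isotropy_degree_le0 sf pf hyp1 Kopen SK Ka.
  by rewrite /= oppr_le0 => le0 ge0; apply/eqP; rewrite eq_le le0.
have [KI _ Ko _] := Kopen.
have KIso b : K b -> Iso b by move=> /KI/interior_subset.
have [gr_a _] := KIso _ Ka.
have [N /(_ N (leqnn N))[mgn ga sub]] := germ_cylinder_nbhs Ko Ka gr_a.
have mn : qpath_left a N = qpath_right a N.
  have [_ [aLR]] := KIso _ Ka.
  by rewrite /qpath_left /qpath_right deg0 subr0 aLR.
rewrite /germ_cylinder -mn in mgn ga sub.
exists (qpath_left a N); exists (repr (qcocycle a) N); split=> //.
split=> // y yn; have /sub/KIso[_] : cylinder (qpath_left a N)
    (repr (qcocycle a) N) (qpath_left a N)
    (cylinder_elt S (qpath_left a N) (repr (qcocycle a) N) (qpath_left a N) y).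
  by exists y.
by case.
Qed.
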